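(* Let $F$ be a binary quartic form with real coefficients and no real roots, and let $\alpha_1,\alpha_2\in\mathbb H^2$ be its two upper-half-plane roots. Then $\xi_{\mathcal J}(F)=\xi_{\mathcal H}(F)$, and this common point is the hyperbolic midpoint of $\alpha_1$ and $\alpha_2$.
   Context: $\mathbb H^2=\{x+iy:y>0\}$ is the upper half-plane with hyperbolic distance $d_H$, $\cosh d_H(x+iy,u+iv)=1+\frac{(x-u)^2+(y-v)^2}{2yv}$. A real binary form of degree $2n$ with no real roots (in $\mathbb P^1(\mathbb R)$) factors as $F(X,Z)=a_0\prod_{i=1}^n (X-\alpha_iZ)(X-\overline{\alpha_i}Z)$ with $a_0\in\mathbb R\setminus\{0\}$; $\alpha_1,\ldots,\alpha_n\in\mathbb H^2$ are its upper-half-plane roots (with multiplicity). The hyperbolic midpoint of two equal points is that point. Julia's zero $\xi_{\mathcal J}(F)$: let $\mathbb H^3=\{z+t\mathbf{j}: z\in\mathbb C,\ t>0\}$, with $\mathbb H^2\subset\mathbb H^3$ via $x+iy\mapsto x+y\mathbf{j}$, and for $w=z+t\mathbf{j}$, $\alpha\in\mathbb C$ put $d_H(w,\alpha)=\ln\frac{|z-\alpha|^2+t^2}{t}$. A form of degree $N$ is stable if none of its roots has multiplicity at least $N/2$. For stable $F$ with all complex roots $\beta_1,\ldots,\beta_{2n}$ (with multiplicity), $\xi_{\mathcal J}(F)$ is the unique point $w\in\mathbb H^3$ minimizing $\sum_{i=1}^{2n} d_H(w,\beta_i)$; for real $F$ with no real roots it lies in $\mathbb H^2$. If such an $F$ is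 not stable, then all $\alpha_i$ equal one point $\alpha$ and by convention $\xi_{\mathcal J}(F)=\alpha$. Hyperbolic zero $\xi_{\mathcal H}(F)$: it is the hyperbolic center of mass of $\alpha_1,\ldots,\alpha_n$, i.e. the unique point $Q\in\mathbb H^2$ minimizing $\sum_{i=1}^n\cosh d_H(Q,\alpha_i)$. *)

(* Defs.v *)
From HB Require Import structures.
From mathcomp Require Import all_boot all_order all_algebra.
From mathcomp Require Import complex mpoly.
From mathcomp Require Import boolp classical_sets reals sequences exp.

Set Implicit Arguments.
Unset Strict Implicit.
Unset Printing Implicit Defensive.

Import Order.TTheory GRing.Theory Num.Theory.
Local Open Scope ring_scope.
Local Open Scope complex_scope.
Local Open Scope classical_set_scope.

Section HyperbolicSpaces.
Variable R : realType.

Definition is_the_minimizer (T : Type) (f : T -> R) : T -> Prop :=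
  unique (fun x => forall y, f x <= f y).

Record H2 := MkH2 { H2val :> R[i]; H2_gt0 : 0 < complex.Im H2val }.
HB.instance Definition _ := [isSub for H2val].
HB.instance Definition _ := [Choice of H2 by <:].

(* The pair (z, t) stands for z + t j. *)
Record H3 := MkH3 { H3val :> R[i] * R; H3_gt0 : 0 < H3val.2 }.
HB.instance Definition _ := [isSub for H3val].
HB.instance Definition _ := [Choice of H3 by <:].

(* x + i y is sent to x + y j. *)
Definition H2_to_H3 (p : H2) : H3 :=
  @MkH3 ((complex.Re p)%:C, complex.Im p) (H2_gt0 p).

Definition coshR (x : R) : R := (expR x + expR (- x)) / 2.
Definition acoshR (x : R) : R := ln (x + Num.sqrt (x ^+ 2 - 1)).

Definition cosh_dist (p q : H2) : R :=
  1 + ((complex.Re p - complex.Re q) ^+ 2 + (complex.Im p - complex.Im q) ^+ 2)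
      / (2 * complex.Im q * complex.Im p).

Definition dH (p q : H2) : R := acoshR (cosh_dist p q).

Lemma acoshRK (x : R) : 1 <= x -> coshR (acoshR x) = x.
Proof.
move=> x1; have x0 : 0 < x by apply: lt_le_trans x1.
set s := Num.sqrt (x ^+ 2 - 1).
have s2 : s ^+ 2 = x ^+ 2 - 1 by rewrite sqr_sqrtr // subr_ge0 exprn_ege1.
have xs0 : 0 < x + s by rewrite ltr_wpDr // sqrtr_ge0.
have xs : (x + s) * (x - s) = 1 by rewrite mulrC -subr_sqr s2 subKr.
have -> : coshR (acoshR x) = (x + s + (x + s)^-1) / 2.
  by rewrite /coshR /acoshR expRN lnK // posrE.
have -> : (x + s)^-1 = x - s.
  by apply: (mulfI (lt0r_neq0 xs0)); rewrite xs divff // lt0r_neq0.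
by rewrite addrACA subrr addr0 -[x + x]mulr2n -(mulr_natr x 2) mulfK // pnatr_eq0.
Qed.

Lemma acoshR_ge0 (x : R) : 1 <= x -> 0 <= acoshR x.
Proof. by move=> x1; apply: ln_ge0; rewrite ler_wpDr // sqrtr_ge0. Qed.

Lemma cosh_dist_ge1 (p q : H2) : 1 <= cosh_dist p q.
Proof.
rewrite lerDl divr_ge0 ?addr_ge0 ?sqr_ge0 //.
by rewrite !mulr_ge0 // ltW // H2_gt0.
Qed.

Lemma cosh_dH (p q : H2) : coshR (dH p q) = cosh_dist p q.
Proof. by apply/acoshRK/cosh_dist_ge1. Qed.

Lemma dH_ge0 (p q : H2) : 0 <= dH p q.
Proof. by apply/acoshR_ge0/cosh_dist_ge1. Qed.

Definition is_hyperbolic_midpoint (m p q : H2) : Prop :=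
  dH m p = dH p q / 2 /\ dH m q = dH p q / 2.

(* Signed distance from a point of hyperbolic 3-space to a boundary point. *)
Definition dH3 (w : H3) (a : R[i]) : R :=
  ln ((Normc.normc ((H3val w).1 - a) ^+ 2 + (H3val w).2 ^+ 2) / (H3val w).2).

Lemma H2_i_gt0 : 0 < complex.Im ('i : R[i]).
Proof. exact: ltr01. Qed.
Definition H2_i : H2 := MkH2 H2_i_gt0.

End HyperbolicSpaces.

(* Binary forms are homogeneous elements of {mpoly K[2]}, with 'X_0 and 'X_1
   in the roles of X and Z. *)
Section BinaryForms.
Variable R : realType.

Definition feval (K : comNzRingType) (F : {mpoly K[2]}) (x z : K) : K :=
  F.@[fun i : 'I_2 => if i == ord0 then x else z].

(* q X - p Z, the linear form vanishing at the point [p : q]. *)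
Definition root_form (K : comNzRingType) (p q : K) : {mpoly K[2]} :=
  q *: 'X_(ord0 : 'I_2) - p *: 'X_(ord_max : 'I_2).

Definition no_real_roots (F : {mpoly R[2]}) : Prop :=
  forall x z : R, (x, z) <> (0, 0) -> feval F x z <> 0.

Definition complexify (F : {mpoly R[2]}) : {mpoly R[i][2]} :=
  map_mpoly (real_complex R) F.

(* s lists all the complex roots of G, with multiplicity; this presupposes that
   the point at infinity [1 : 0] is not a root. *)
Definition complex_roots (G : {mpoly R[i][2]}) (s : seq R[i]) : Prop :=
  exists2 c : R[i], c != 0 & G = c *: \prod_(b <- s) root_form b 1.

Definition upper_roots (F : {mpoly R[2]}) (s : seq (H2 R)) : Prop :=
  exists2 a0 : R, a0 != 0 &
    complexify F =
      a0%:C *: \prod_(a <- s) (root_form (a : R[i]) 1 * root_form (a : R[i])^* 1).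

(* For a form G of degree N: the multiplicity of a root [p : q] in P^1(C) is
   the largest m such that (q X - p Z)^m divides G. *)
Definition stable (N : nat) (G : {mpoly R[i][2]}) : Prop :=
  forall p q : R[i], (p, q) <> (0, 0) -> feval G p q = 0 ->
  forall m : nat, (exists H, G = root_form p q ^+ m * H) -> (m.*2 < N)%N.

(* Here F has degree 2n. *)
Definition is_julia_zero (n : nat) (F : {mpoly R[2]}) (w : H3 R) : Prop :=
  (stable n.*2 (complexify F) ->
     exists2 s, complex_roots (complexify F) s &
       is_the_minimizer (fun v : H3 R => \sum_(b <- s) dH3 v b) w) /\
  (~ stable n.*2 (complexify F) ->
     exists2 a, upper_roots F (nseq n a) & w = H2_to_H3 a).

Definition is_hyperbolic_zero (F : {mpoly R[2]}) (Q : H2 R) : Prop :=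
  exists2 s, upper_roots F s &
    is_the_minimizer (fun P : H2 R => \sum_(a <- s) coshR (dH P a)) Q.

(* The default values of xget are irrelevant whenever the zeros exist. *)
Definition julia_zero (n : nat) (F : {mpoly R[2]}) : H3 R :=
  xget (H2_to_H3 (H2_i R)) [set w | is_julia_zero n F w].

Definition hyperbolic_zero (F : {mpoly R[2]}) : H2 R :=
  xget (H2_i R) [set Q | is_hyperbolic_zero F Q].

End BinaryForms.

(* Main.v *)
Require Import Defs.
From HB Require Import structures.
From mathcomp Require Import all_boot all_order all_algebra.
From mathcomp Require Import ring lra.
From mathcomp Require Import complex mpoly.
From mathcomp Require Import boolp classical_sets reals sequences exp.

(** Write [c1], [c2], [c] for [cosh d(P, p)], [cosh d(P, q)], [cosh d(p, q)],
    where [p] and [q] are the two upper roots of the quartic, and let [m] be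
    the midpoint of [p] and [q].  Both zeros equal [m], for related reasons.

    - Hyperbolic zero.  The function [c1 + c2] of [P] is a constant multiple of
      [cosh d(P, m)] ([sum_cosh_dist]): in the hyperboloid model [cosh d] is
      the Lorentz bilinear form, and the sum of the vectors of [p] and [q]
      points towards [m].  Hence [m] is the only minimizer.

    - Julia's zero, [p] and [q] distinct.  For [w = x + i u + t j], rotating
      [w] about the real line down to the half-plane gives a point
      [foot w] at height [sqrt (u^2 + t^2)] over [x].  The two terms of
      the sum belonging to a pair of conjugate roots combine into the logarithm
      of [(2 Im p)^2 (C^2 + (u / t)^2 (C^2 - 1))] with [C = cosh d(foot w, p)]
      ([dH3_conj_pair]).  Going from [w] to [foot w] thus does not increase
      the sum, and what remains is to minimize the product [c1 c2] over the
      half-plane.  The Gram determinant of three points of the hyperboloid is a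
      square, so [1 + 2 c c1 c2 - c^2 - c1^2 - c2^2 >= 0], that is,
      [(c - 1) (2 c1 c2 - (1 + c)) >= (c1 - c2)^2].  So [2 c1 c2 >= 1 + c],
      with equality only if [c1 = c2 = sqrt ((1 + c) / 2)].  Then [c1 + c2]
      has its minimal value, and the first item gives [P = m].

    - The two roots coincide exactly when the form is not stable
      ([stable_quartic]); the midpoint is then the double root, which is the
      conventional value of Julia's zero.

    Dehomogenizing to a univariate polynomial shows that a form determines its
    roots up to order, so that the zeros may be computed with any list of
    roots. *)

Set Implicit Arguments.
Unset Strict Implicit.
Unset Printing Implicit Defensive.

Import Order.TTheory GRing.Theory Num.Theory.
Local Open Scope ring_scope.
Local Open Scope complex_scope.

(** * Distances and midpoints in the hyperbolic plane *)

Section HyperbolicPlane.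
Variable R : realType.
Implicit Types p q P m : H2 R.

Lemma H2_eqP p q :
  complex.Re p = complex.Re q -> complex.Im p = complex.Im q -> p = q.
Proof.
by case: p q => [[x y] y0] [[u v] v0] /= xu yv; apply: val_inj; rewrite /= xu yv.
Qed.

Lemma coshR_inj (x y : R) : 0 <= x -> 0 <= y -> coshR x = coshR y -> x = y.
Proof.
move=> x0 y0; rewrite /coshR !expRN.
move=> /(mulIf (invr_neq0 (lt0r_neq0 (ltr0Sn _ _)))).
have ex := expR_gt0 x; have ey := expR_gt0 y.
move=> h; apply: expR_inj.
have : (expR x - expR y) * (expR x * expR y - 1) = 0.
  have -> : (expR x - expR y) * (expR x * expR y - 1) =
    expR x * expR y * ((expR x + (expR x)^-1) - (expR y + (expR y)^-1)).
    by field; rewrite !gt_eqF.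
  by rewrite h subrr mulr0.
move/eqP; rewrite mulf_eq0 !subr_eq0 => /orP[/eqP //|/eqP].
rewrite -expRD -[RHS]expR0 => /expR_inj xy.
by congr expR; lra.
Qed.

Lemma coshR_double (x : R) : coshR (2 * x) = 2 * coshR x ^+ 2 - 1.
Proof.
rewrite /coshR !expRN (_ : 2 * x = x + x) ?expRD; last by ring.
by field; rewrite gt_eqF ?expR_gt0.
Qed.

Lemma cosh_distxx p : cosh_dist p p = 1.
Proof. by rewrite /cosh_dist !subrr expr0n addr0 mul0r addr0. Qed.

(** Together with [cosh_dist_ge1], this turns every uniqueness claim below into
    a comparison of hyperbolic cosines. *)
Lemma cosh_dist_eq1 p q : cosh_dist p q = 1 -> p = q.
Proof.
have yp := H2_gt0 p; have yq := H2_gt0 q.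
rewrite /cosh_dist -[RHS]addr0 => /addrI /eqP.
rewrite mulf_eq0 invr_eq0 (gt_eqF (mulr_gt0 _ yp)) ?mulr_gt0 // orbF.
rewrite paddr_eq0 ?sqr_ge0 // !sqrf_eq0 !subr_eq0 => /andP[/eqP h1 /eqP h2].
exact: H2_eqP.
Qed.

(** The point representing, in the hyperboloid model, the direction of the sum
    of the vectors of [p] and [q]; its coordinates complete the squares in
    [cosh d(P, p) + cosh d(P, q)], seen as a function of [P]. *)
Definition midpoint_Re p q : R :=
  (complex.Re p * complex.Im q + complex.Re q * complex.Im p)
    / (complex.Im p + complex.Im q).

Definition midpoint_Im p q : R :=
  Num.sqrt (complex.Im p * complex.Im q
    * ((complex.Re p - complex.Re q) ^+ 2 + (complex.Im p + complex.Im q) ^+ 2))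
    / (complex.Im p + complex.Im q).

Lemma midpoint_Im_gt0 p q : 0 < complex.Im (midpoint_Re p q +i* midpoint_Im p q).
Proof.
have yp := H2_gt0 p; have yq := H2_gt0 q.
rewrite /= /midpoint_Im divr_gt0 ?addr_gt0 // sqrtr_gt0 !mulr_gt0 //.
by rewrite ltr_wpDl ?sqr_ge0 // exprn_gt0 // addr_gt0.
Qed.

Definition midpoint p q : H2 R := MkH2 (midpoint_Im_gt0 p q).

Lemma midpoint_Im_sqr p q :
  midpoint_Im p q ^+ 2 =
    complex.Im p * complex.Im q
    * ((complex.Re p - complex.Re q) ^+ 2 + (complex.Im p + complex.Im q) ^+ 2)
    / (complex.Im p + complex.Im q) ^+ 2.
Proof.
have yp := H2_gt0 p; have yq := H2_gt0 q.
rewrite /midpoint_Im expr_div_n sqr_sqrtr //.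
by rewrite !mulr_ge0 ?ltW // ltr_wpDl ?sqr_ge0 // exprn_gt0 // addr_gt0.
Qed.

Lemma midpoint_sym p q : midpoint p q = midpoint q p.
Proof.
apply: H2_eqP; rewrite /= /midpoint_Re /midpoint_Im.
  by rewrite [in LHS]addrC [X in _ / X]addrC.
congr (Num.sqrt _ / _); by ring.
Qed.

Lemma cosh_dist_midpointE p q :
  cosh_dist (midpoint p q) p =
    (complex.Im p + complex.Im q) / (2 * complex.Im p * complex.Im q)
      * midpoint_Im p q.
Proof.
have yp := H2_gt0 p; have yq := H2_gt0 q.
have k0 : 0 < midpoint_Im p q := midpoint_Im_gt0 p q.
have k2 := midpoint_Im_sqr p q.
rewrite /cosh_dist /= /midpoint_Re; move: k0 k2.
set k := midpoint_Im p q.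
move: (complex.Re p) (complex.Re q) (complex.Im p) (complex.Im q) yp yq.
move=> x u y v y0 v0 k0 k2.
have S0 : y + v != 0 by rewrite gt_eqF // addr_gt0.
have n := (gt_eqF k0, gt_eqF y0, gt_eqF v0).
apply: (mulfI (negbT n.1.1)); rewrite [RHS]mulrCA -expr2 k2.
transitivity (((x * v + u * y) / (y + v) - x) ^+ 2 / (2 * y) + y / 2 + k ^+ 2 / (2 * y)).
  by field; rewrite !n S0.
by rewrite k2; field; rewrite !n S0.
Qed.

Lemma cosh_dist_midpoint_eq p q :
  cosh_dist (midpoint p q) p = cosh_dist (midpoint p q) q.
Proof.
rewrite cosh_dist_midpointE midpoint_sym cosh_dist_midpointE.
have := congr1 (fun m : H2 R => complex.Im m) (midpoint_sym p q) => /= ->.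
by congr (_ / _ * _); ring.
Qed.

(** The half-angle formula [cosh d = 2 cosh^2 (d / 2) - 1] in disguise, which
    identifies the common distance from the midpoint as half of [d(p, q)]. *)
Lemma cosh_dist_midpoint_sqr p q :
  2 * cosh_dist (midpoint p q) p ^+ 2 = 1 + cosh_dist p q.
Proof.
have yp := H2_gt0 p; have yq := H2_gt0 q.
rewrite cosh_dist_midpointE exprMn midpoint_Im_sqr /cosh_dist.
by field; rewrite !gt_eqF // addr_gt0.
Qed.

(** As a function of [P], the sum is linear in the hyperboloid vector of [P],
    hence a multiple of [cosh d(P, m)]; the factor is found at [P = m]. *)
Lemma sum_cosh_dist P p q :
  cosh_dist P p + cosh_dist P q =
    2 * cosh_dist (midpoint p q) p * cosh_dist P (midpoint p q).
Proof.
have yp := H2_gt0 p; have yq := H2_gt0 q; have yP := H2_gt0 P.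
rewrite cosh_dist_midpointE.
have k0 : 0 < midpoint_Im p q := midpoint_Im_gt0 p q.
have k2 := midpoint_Im_sqr p q.
rewrite /cosh_dist /= /midpoint_Re; move: k0 k2.
set k := midpoint_Im p q.
move: (complex.Re p) (complex.Re q) (complex.Im p) (complex.Im q) yp yq.
move: (complex.Re P) (complex.Im P) yP.
move=> a b b0 x u y v y0 v0 k0 k2.
have S0 : y + v != 0 by rewrite gt_eqF // addr_gt0.
have n := (gt_eqF k0, gt_eqF y0, gt_eqF v0, gt_eqF b0).
(* Complete the squares in a and b before introducing the value of k ^+ 2. *)
transitivity ((y + v) / (2 * y * v * b) *
   ((a - (x * v + u * y) / (y + v)) ^+ 2 + b ^+ 2 + k ^+ 2)).
  by rewrite k2; field; rewrite !n S0.
by field; rewrite !n S0.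
Qed.

(** The Gram matrix of three vectors for a form of signature (1, 2) has a
    nonnegative determinant: it is the determinant of the form, which is
    positive, times the square of the determinant of the vectors. *)
Lemma cosh_dist_gram P p q :
  0 <= 1 + 2 * cosh_dist p q * cosh_dist P p * cosh_dist P q
       - cosh_dist p q ^+ 2 - cosh_dist P p ^+ 2 - cosh_dist P q ^+ 2.
Proof.
have yp := H2_gt0 p; have yq := H2_gt0 q; have yP := H2_gt0 P.
rewrite /cosh_dist.
move: (complex.Re p) (complex.Re q) (complex.Im p) (complex.Im q) yp yq.
move: (complex.Re P) (complex.Im P) yP => a b b0 x u y v y0 v0.
have n := (gt_eqF y0, gt_eqF v0, gt_eqF b0).
(* Up to the scaling by the heights, the squared quantity is the determinant of
   the vectors (1, x, x^2 + y^2) attached to the three points. *)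
rewrite [X in 0 <= X](_ : _ =
  (((x - a) * (u ^+ 2 + v ^+ 2 - a ^+ 2 - b ^+ 2)
    - (u - a) * (x ^+ 2 + y ^+ 2 - a ^+ 2 - b ^+ 2)) / (2 * b * y * v)) ^+ 2).
  exact: sqr_ge0.
by field; rewrite !n.
Qed.

Lemma cosh_dist_gt1 p q : p <> q -> 1 < cosh_dist p q.
Proof.
move=> pq; rewrite lt_neqAle cosh_dist_ge1 andbT eq_sym.
by apply/eqP => /cosh_dist_eq1.
Qed.

(** The Gram inequality reads
    [(c - 1) (2 c1 c2 - (1 + c)) >= (c1 - c2)^2], and [c > 1]. *)
Lemma prod_cosh_dist_ge P p q : p <> q ->
  1 + cosh_dist p q <= 2 * (cosh_dist P p * cosh_dist P q).
Proof.
move=> /cosh_dist_gt1 c1; have g := cosh_dist_gram P p q.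
have s := sqr_ge0 (cosh_dist P p - cosh_dist P q).
rewrite -subr_ge0 -(pmulr_rge0 _ (_ : 0 < cosh_dist p q - 1)); last by lra.
nra.
Qed.

(** Equality forces [c1 = c2] in the Gram inequality, hence
    [c1^2 = (1 + c) / 2], the value at the midpoint; then [c1 + c2] is minimal
    as well, and [sum_cosh_dist] identifies [P]. *)
Lemma prod_cosh_dist_eq P p q : p <> q ->
  2 * (cosh_dist P p * cosh_dist P q) = 1 + cosh_dist p q -> P = midpoint p q.
Proof.
move=> /cosh_dist_gt1 c1 e; have g := cosh_dist_gram P p q.
have /eqP : (cosh_dist P p - cosh_dist P q) ^+ 2 = 0.
  by apply/eqP; rewrite eq_le sqr_ge0 andbT; nra.
rewrite sqrf_eq0 subr_eq0 => /eqP e'.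
have d := cosh_dist_midpoint_sqr p q; have s := sum_cosh_dist P p q.
have := cosh_dist_ge1 (midpoint p q) p; have := cosh_dist_ge1 P p.
have := cosh_dist_ge1 P (midpoint p q); rewrite -e' in e s.
move=> h1 h2 h3; apply: cosh_dist_eq1.
have h4 : cosh_dist P p = cosh_dist (midpoint p q) p.
  by apply/eqP; rewrite -(@eqrXn2 _ 2) //; [apply/eqP|..]; lra.
rewrite h4 in s; apply: (mulfI (_ : cosh_dist (midpoint p q) p != 0)).
  by rewrite gt_eqF //; lra.
lra.
Qed.

Lemma midpoint_is_midpoint p q : is_hyperbolic_midpoint (midpoint p q) p q.
Proof.
have half m : 2 * cosh_dist m p ^+ 2 = 1 + cosh_dist p q -> dH m p = dH p q / 2.
  move=> h; apply: (mulfI (_ : 2%:R != 0)); first by rewrite pnatr_eq0.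
  rewrite [RHS]mulrC divfK ?pnatr_eq0 //.
  apply: coshR_inj; rewrite ?mulr_ge0 ?dH_ge0 //.
  by rewrite coshR_double !cosh_dH h addrC addKr.
split; first exact/half/cosh_dist_midpoint_sqr.
rewrite /dH -cosh_dist_midpoint_eq; exact/half/cosh_dist_midpoint_sqr.
Qed.

Lemma midpointxx p : midpoint p p = p.
Proof.
apply: cosh_dist_eq1; have := cosh_dist_midpoint_sqr p p.
rewrite cosh_distxx; have := cosh_dist_ge1 (midpoint p p) p.
by move=> *; nra.
Qed.

Lemma midpoint_center_of_mass p q :
  is_the_minimizer (fun P => coshR (dH P p) + coshR (dH P q)) (midpoint p q).
Proof.
have E P : coshR (dH P p) + coshR (dH P q) =
    2 * cosh_dist (midpoint p q) p * cosh_dist P (midpoint p q).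
  by rewrite !cosh_dH sum_cosh_dist.
have c0 : 0 < 2 * cosh_dist (midpoint p q) p.
  by rewrite mulr_gt0 // (lt_le_trans ltr01) // cosh_dist_ge1.
split=> [P|P minP].
  by rewrite !E ler_pM2l // cosh_distxx cosh_dist_ge1.
apply/esym/cosh_dist_eq1/eqP; rewrite eq_le cosh_dist_ge1 andbT.
by have := minP (midpoint p q); rewrite !E ler_pM2l // cosh_distxx.
Qed.

(** * Julia's sum in hyperbolic space *)

Lemma foot_gt0 (w : H3 R) :
  0 < complex.Im (complex.Re (H3val w).1
        +i* Num.sqrt (complex.Im (H3val w).1 ^+ 2 + (H3val w).2 ^+ 2)).
Proof. by rewrite /= sqrtr_gt0 ltr_wpDl ?sqr_ge0 // exprn_gt0 // H3_gt0. Qed.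

(** The image of [w] under the rotation about the real line that brings it to
    the half-plane; it is also the orthogonal projection, since the geodesic
    from [w] perpendicular to the half-plane is an arc of this circle. *)
Definition foot (w : H3 R) : H2 R := MkH2 (foot_gt0 w).

Lemma foot_H2_to_H3 P : foot (H2_to_H3 P) = P.
Proof.
apply: H2_eqP => //=; rewrite expr0n add0r sqrtr_sqr ger0_norm //.
exact/ltW/H2_gt0.
Qed.

Lemma H2_to_H3_foot (w : H3 R) :
  complex.Im (H3val w).1 = 0 -> w = H2_to_H3 (foot w).
Proof.
case: w => [[[x u] t] /= t0] u0; apply: val_inj => /=.
by rewrite u0 expr0n add0r sqrtr_sqr ger0_norm // ltW.
Qed.

(** The hyperbolic sine of the signed distance from [w] to the half-plane. *)
Definition slope (w : H3 R) : R := complex.Im (H3val w).1 / (H3val w).2.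

Lemma slope_eq0 (w : H3 R) : slope w = 0 -> w = H2_to_H3 (foot w).
Proof.
move/eqP; rewrite mulf_eq0 invr_eq0 (gt_eqF (H3_gt0 w)) orbF => /eqP.
exact: H2_to_H3_foot.
Qed.

Definition pair_weight (w : H3 R) p : R :=
  cosh_dist (foot w) p ^+ 2 + slope w ^+ 2 * (cosh_dist (foot w) p ^+ 2 - 1).

(** With [s = |x - a|^2 + b^2 + r^2], where [r^2 = u^2 + t^2] and
    [p = a + i b], the product of the two arguments of the logarithms is
    [(s^2 - 4 u^2 b^2) / t^2], while [s = 2 b r cosh d(foot w, p)]. *)
Lemma dH3_conj_pair (w : H3 R) p :
  dH3 w p + dH3 w (p : R[i])^* =
    ln ((2 * complex.Im p) ^+ 2 * pair_weight w p).
Proof.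
have yp := H2_gt0 p; case: w => [[[x u] t] /= t0].
have arg0 (a b : R) : (a ^+ 2 + b ^+ 2 + t ^+ 2) / t \in Num.pos.
  by rewrite posrE divr_gt0 // ltr_wpDl ?addr_ge0 ?sqr_ge0 // exprn_gt0.
rewrite /dH3 /pair_weight /slope /cosh_dist.
case: p yp => [[a b] /= b0] _.
rewrite !sqr_sqrtr ?addr_ge0 ?sqr_ge0 // opprK -lnM ?arg0 //; congr ln.
have : 0 < Num.sqrt (u ^+ 2 + t ^+ 2).
  by rewrite sqrtr_gt0 ltr_wpDl ?sqr_ge0 // exprn_gt0.
have : Num.sqrt (u ^+ 2 + t ^+ 2) ^+ 2 = u ^+ 2 + t ^+ 2.
  by rewrite sqr_sqrtr // addr_ge0 ?sqr_ge0.
move: (Num.sqrt _) => r r2 r0.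
have n := (gt_eqF r0, gt_eqF t0, gt_eqF b0).
(* Expose r as r ^+ 2 only, which is a polynomial in u and t. *)
have -> : (1 + ((x - a) ^+ 2 + (r - b) ^+ 2) / (2 * b * r)) ^+ 2 =
   (((x - a) ^+ 2 + b ^+ 2 + r ^+ 2) / (2 * b)) ^+ 2 / r ^+ 2.
  by field; rewrite !n.
rewrite r2; field; rewrite !n /=.
by rewrite gt_eqF // ltr_wpDl ?sqr_ge0 // exprn_gt0.
Qed.

Lemma sqr_cosh_dist_ge1 p q : 1 <= cosh_dist p q ^+ 2.
Proof. by rewrite exprn_ege1 // cosh_dist_ge1. Qed.

Lemma pair_weight_ge (w : H3 R) p : cosh_dist (foot w) p ^+ 2 <= pair_weight w p.
Proof. by rewrite lerDl mulr_ge0 ?sqr_ge0 // subr_ge0 sqr_cosh_dist_ge1. Qed.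

Lemma pair_weight_gt0 (w : H3 R) p : 0 < pair_weight w p.
Proof.
rewrite (lt_le_trans _ (pair_weight_ge w p)) // (lt_le_trans ltr01) //.
exact: sqr_cosh_dist_ge1.
Qed.

Lemma pair_weight_H2 P p : pair_weight (H2_to_H3 P) p = cosh_dist P p ^+ 2.
Proof.
by rewrite /pair_weight foot_H2_to_H3 /slope /= mul0r expr0n mul0r addr0.
Qed.

(** The product of the two weights at [w] is at least [(c1 c2)^2], taken at
    [P = foot w], by [pair_weight_ge], and this is at least
    [((1 + c) / 2)^2], the value at [m].  At a minimizer both bounds are
    equalities: the last one gives [foot w = m], and then the first one gives
    [slope w = 0] because [cosh d(m, p) > 1]. *)
Lemma midpoint_julia p q : p <> q ->
  is_the_minimizer
    (fun w => dH3 w p + dH3 w (p : R[i])^* + (dH3 w q + dH3 w (q : R[i])^*))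
    (H2_to_H3 (midpoint p q)).
Proof.
move=> pq; have c1 := cosh_dist_gt1 pq.
have K0 : 0 < (2 * complex.Im p) ^+ 2 * (2 * complex.Im q) ^+ 2.
  by rewrite mulr_gt0 // exprn_gt0 // mulr_gt0 // H2_gt0.
have E (w : H3 R) : dH3 w p + dH3 w (p : R[i])^* + (dH3 w q + dH3 w (q : R[i])^*) =
   ln ((2 * complex.Im p) ^+ 2 * (2 * complex.Im q) ^+ 2
        * (pair_weight w p * pair_weight w q)).
  rewrite !dH3_conj_pair -lnM ?posrE ?mulr_gt0 ?pair_weight_gt0 ?exprn_gt0
    ?mulr_gt0 ?H2_gt0 //.
  by rewrite mulrACA.
have le w v : (dH3 w p + dH3 w (p : R[i])^* + (dH3 w q + dH3 w (q : R[i])^*) <=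
   dH3 v p + dH3 v (p : R[i])^* + (dH3 v q + dH3 v (q : R[i])^*)) =
   (pair_weight w p * pair_weight w q <= pair_weight v p * pair_weight v q).
  by rewrite !E ler_ln ?posrE ?(mulr_gt0 K0) ?mulr_gt0 ?pair_weight_gt0 // ler_pM2l.
set m := midpoint p q.
have wm : pair_weight (H2_to_H3 m) p * pair_weight (H2_to_H3 m) q =
    ((1 + cosh_dist p q) / 2) ^+ 2.
  rewrite !pair_weight_H2 -cosh_dist_midpoint_eq -cosh_dist_midpoint_sqr.
  by rewrite [2 * _]mulrC mulfK ?pnatr_eq0.
have ge1 (w : H3 R) : (cosh_dist (foot w) p * cosh_dist (foot w) q) ^+ 2 <=
    pair_weight w p * pair_weight w q.
  by rewrite exprMn ler_pM ?sqr_ge0 ?pair_weight_ge.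
have ge2 P : ((1 + cosh_dist p q) / 2) ^+ 2 <= (cosh_dist P p * cosh_dist P q) ^+ 2.
  have := prod_cosh_dist_ge P pq => h.
  by rewrite ler_pXn2r ?nnegrE //; lra.
split=> [w|w minw].
  by rewrite le wm (le_trans (ge2 _) (ge1 _)).
have := minw (H2_to_H3 m); rewrite le wm => up.
have fw : foot w = m.
  apply: prod_cosh_dist_eq => //; have h := prod_cosh_dist_ge (foot w) pq.
  have h' : cosh_dist (foot w) p * cosh_dist (foot w) q <= (1 + cosh_dist p q) / 2.
    by rewrite -(@ler_pXn2r _ 2) ?nnegrE ?(le_trans (ge1 _)) //; lra.
  lra.
rewrite (@slope_eq0 w) ?fw //.
have d := cosh_dist_midpoint_sqr p q.
have e := cosh_dist_midpoint_eq p q.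
move: up; rewrite /pair_weight fw /m -e -d.
set c := cosh_dist _ p in d *; rewrite [2 * _]mulrC mulfK ?pnatr_eq0 //.
move=> up; apply/eqP; rewrite -sqrf_eq0 eq_le sqr_ge0 andbT.
have c2 : 1 < c ^+ 2 by lra.
move: (slope w ^+ 2) (c ^+ 2) c2 up => S a a1 up.
rewrite leNgt; apply/negP => S0; move: up; apply/negP; rewrite -ltNge.
have : 0 < S * (a - 1) by rewrite mulr_gt0 // subr_gt0.
move: (S * _) => T T0; nra.
Qed.

End HyperbolicPlane.

(** * Roots of binary forms *)

Section Roots.
Variable R : realType.
Implicit Types (F : {mpoly R[2]}) (G : {mpoly R[i][2]}) (s t : seq R[i]).

(** Evaluation at [X = 'X] and [Z = 1]: it carries lists of roots of a form to
    lists of roots of a univariate polynomial. *)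
Definition dehomog G : {poly R[i]} :=
  mmap (@polyC R[i]) (fun i : 'I_2 => if i == ord0 then 'X else 1) G.

HB.instance Definition _ := GRing.RMorphism.copy dehomog
  (mmap (@polyC R[i]) (fun i : 'I_2 => if i == ord0 then 'X else 1)).

Lemma dehomogZ c G : dehomog (c *: G) = c%:P * dehomog G.
Proof. exact: mmapZ. Qed.

Lemma dehomog_root_form (p q : R[i]) :
  dehomog (root_form p q) = q%:P * 'X - p%:P.
Proof.
by rewrite /root_form rmorphB /= !dehomogZ /dehomog !mmapX !mmap1U /= mulr1.
Qed.

Lemma dehomog_roots c s :
  dehomog (c *: \prod_(b <- s) root_form b 1) =
    c%:P * \prod_(b <- s) ('X - b%:P).
Proof.
rewrite dehomogZ rmorph_prod; congr (_ * _).
by apply: eq_bigr => b _; rewrite /= dehomog_root_form mul1r.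
Qed.

Lemma complex_roots_perm G s t :
  complex_roots G s -> complex_roots G t -> perm_eq s t.
Proof.
case=> c c0 -> [d d0 e].
have {}e : c%:P * \prod_(b <- s) ('X - b%:P) = d%:P * \prod_(b <- t) ('X - b%:P).
  by rewrite -!dehomog_roots e.
have cd : c = d.
  have := congr1 lead_coef e.
  by rewrite !lead_coefM !lead_coefC !(monicP (monic_prod_XsubC _ _ _)) !mulr1.
have c0' : c%:P != 0 by rewrite polyC_eq0.
by rewrite -cd in e; apply: prod_XsubC_eq; apply: mulfI e.
Qed.

Lemma feval_root_form (p q x z : R[i]) : feval (root_form p q) x z = q * x - p * z.
Proof. by rewrite /feval /root_form mevalB !mevalZ !mevalXU. Qed.

Lemma feval_roots c s (x z : R[i]) :
  feval (c *: \prod_(b <- s) root_form b 1) x z = c * \prod_(b <- s) (x - b * z).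
Proof.
rewrite /feval mevalZ rmorph_prod; congr (_ * _).
by apply: eq_bigr => b _; rewrite -[LHS]/(feval _ x z) feval_root_form mul1r.
Qed.

(** The multiplicity of a finite root is its number of occurrences in [s]; the
    point at infinity is not a root, as the form takes a nonzero value there. *)
Lemma stableE N G s : (0 < N)%N -> complex_roots G s ->
  stable N G <-> forall b, ((count_mem b s).*2 < N)%N.
Proof.
move=> N0 [c c0 ->]; split=> [st b|small p q pq].
  have [bs|bs] := boolP (b \in s); last by rewrite (count_memPn bs) double0.
  apply: (st b 1).
  - by case=> _ /eqP; rewrite oner_eq0.
  - rewrite feval_roots (perm_big _ (perm_to_rem bs)) big_cons /=.
    by rewrite mulr1 subrr mul0r mulr0.
  exists (c *: \prod_(a <- s | a != b) root_form a 1).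
  rewrite (bigID (pred1 b)) /= -scalerAr; congr (_ *: (_ * _)).
  rewrite (eq_bigr (fun=> root_form b 1)) => [|a /eqP -> //].
  by rewrite big_const_seq iter_mulr_1.
rewrite feval_roots => /eqP; rewrite mulf_eq0 (negPf c0) /= => /eqP root0.
(* The root [p : q] is not the point at infinity. *)
have q0 : q != 0.
  apply: contra_not_neq pq => q0; congr (_, _) => //; apply/eqP.
  move/eqP: root0; rewrite q0 prodf_seq_eq0 => /hasP[b _].
  by rewrite /= mulr0 subr0.
move=> m [H] /(congr1 dehomog).
rewrite dehomog_roots rmorphM rmorphXn /= dehomog_root_form => e.
have P0 : c%:P * \prod_(b <- s) ('X - b%:P) != 0.
  by rewrite mulf_neq0 ?polyC_eq0 // monic_neq0 // monic_prod_XsubC.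
(* Up to a unit, the linear form of the root becomes 'X - p / q. *)
have : (m <= mup (p / q) (c%:P * \prod_(b <- s) ('X - b%:P)))%N.
  rewrite mup_geq // e dvdp_mulr // dvdp_exp2r //.
  have -> : q%:P * 'X - p%:P = q%:P * ('X - (p / q)%:P).
    by rewrite mulrBr -polyCM mulrCA divff // mulr1.
  by rewrite dvdp_mull.
rewrite mupMr ?rootC // mu_prod_XsubC => /leq_trans - le.
by apply: leq_ltn_trans (small (p / q)); rewrite leq_double le.
Qed.

Definition conj_closure (s : seq (H2 R)) : seq R[i] :=
  flatten [seq [:: H2val a; (H2val a)^*] | a <- s].

Lemma filter_conj_closure (s : seq (H2 R)) :
  [seq b <- conj_closure s | 0 < complex.Im b] = [seq H2val a | a <- s].
Proof.
elim: s => //= a s IH; rewrite H2_gt0 /=.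
have -> : (0 < complex.Im (H2val a)^*) = false.
  by case: a => [[x y] /= y0]; rewrite oppr_gt0 ltNge ltW.
by rewrite [X in _ :: X]IH.
Qed.

Lemma upper_complex_roots F (s : seq (H2 R)) :
  upper_roots F s -> complex_roots (complexify F) (conj_closure s).
Proof.
case=> a a0 ->; exists a%:C; first by rewrite eq_complex /= eqxx andbT.
congr (_ *: _); rewrite /conj_closure.
elim: s => [|b s IH]; first by rewrite !big_nil.
by rewrite big_cons IH /= !big_cons mulrA.
Qed.

(** The upper roots are recovered from the list of all complex roots by keeping
    those with positive imaginary part. *)
Lemma upper_roots_perm F (s t : seq (H2 R)) :
  upper_roots F s -> upper_roots F t -> perm_eq s t.
Proof.
move=> /upper_complex_roots hs /upper_complex_roots ht.
apply: (@perm_map_inj _ _ (@H2val R)); first exact: val_inj.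
rewrite -!filter_conj_closure; apply: perm_filter.
exact: complex_roots_perm ht.
Qed.

End Roots.

(** * The two zeros of a quartic *)

Section Quartic.
Variable R : realType.
Implicit Types (F : {mpoly R[2]}) (p q : H2 R).

(** For degree 4, stability says that all roots are simple; as no point
    of the upper half-plane is conjugate to another, only [p] and [q] can
    coincide. *)
Lemma stable_quartic F p q : upper_roots F [:: p; q] ->
  stable 4 (complexify F) <-> p <> q.
Proof.
move=> /upper_complex_roots hpq; rewrite (stableE _ hpq) //=.
rewrite /conj_closure /=; split=> [+ pq|pq b].
  by move/(_ (p : R[i])); rewrite -pq /= !eqxx /= ; case: (_ == _).
have : uniq [:: (p : R[i]); (p : R[i])^*; (q : R[i]); (q : R[i])^*].
  have nconj (a a' : H2 R) : (a : R[i]) != (a' : R[i])^*.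
    apply/eqP => /(congr1 (@complex.Im R)).
    have := H2_gt0 a; have := H2_gt0 a'.
    case: a a' => [[x y] _] [[u v] _] /= v0 + e.
    by rewrite e oppr_gt0 ltNge ltW.
  have neq : (p : R[i]) != q by apply/eqP => /val_inj.
  have neq' : (p : R[i])^* != (q : R[i])^*.
    apply: contraNneq neq => /(congr1 (@conjc R)).
    by rewrite !conjcK => ->.
  by rewrite /= !inE !negb_or !nconj neq neq' eq_sym nconj.
by move/count_uniq_mem => /(_ b) /= ->; case: (_ \in _).
Qed.

Lemma is_julia_zeroE F p q (w : H3 R) : upper_roots F [:: p; q] ->
  is_julia_zero 2 F w <-> w = H2_to_H3 (midpoint p q).
Proof.
move=> hpq; have st := stable_quartic hpq.
have roots := upper_complex_roots hpq.
have sumE s : complex_roots (complexify F) s ->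
    (fun v : H3 R => \sum_(b <- s) dH3 v b) =
    (fun v => dH3 v p + dH3 v (p : R[i])^* + (dH3 v q + dH3 v (q : R[i])^*)).
  move=> hs; apply/funext => v.
  rewrite (perm_big _ (complex_roots_perm hs roots)) /=.
  by rewrite !big_cons big_nil addr0 addrA.
split=> [[stab unstab]|->].
  have [pq|/eqP pq] := eqVneq p q; last first.
    have [s hs] := stab (st.2 pq); rewrite (sumE _ hs) => -[minw _].
    by rewrite ((midpoint_julia pq).2 w minw).
  have [|a ha ->] := unstab; first by move=> /st /(_ pq).
  rewrite -pq midpointxx; congr H2_to_H3; apply/eqP.
  have := perm_mem (upper_roots_perm hpq ha) p.
  by rewrite -pq /= !inE !orbb eqxx eq_sym => <-.
split=> [/st pq|/st pq].
  exists (conj_closure [:: p; q]) => //; rewrite (sumE _ roots).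
  exact: midpoint_julia.
have {}pq : p = q by apply: contrapT.
by exists p; rewrite -?pq ?midpointxx // in hpq *.
Qed.

Lemma is_hyperbolic_zeroE F p q (Q : H2 R) : upper_roots F [:: p; q] ->
  is_hyperbolic_zero F Q <-> Q = midpoint p q.
Proof.
move=> hpq.
have sumE s : upper_roots F s ->
    (fun P : H2 R => \sum_(a <- s) coshR (dH P a)) =
    (fun P => coshR (dH P p) + coshR (dH P q)).
  move=> hs; apply/funext => P.
  by rewrite (perm_big _ (upper_roots_perm hs hpq)) /= !big_cons big_nil addr0.
split=> [[s hs]|->]; last first.
  by exists [:: p; q] => //; rewrite (sumE _ hpq); exact: midpoint_center_of_mass.
rewrite (sumE _ hs) => -[minQ _].
by rewrite ((midpoint_center_of_mass p q).2 Q minQ).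
Qed.

End Quartic.

Theorem proposition11 (R : realType) (F : {mpoly R[2]})
    (hF : F \is 4.-homog) (hroots : no_real_roots F)
    (alpha1 alpha2 : H2 R) (halpha : upper_roots F [:: alpha1; alpha2]) :
  [/\ is_julia_zero 2 F (julia_zero 2 F),
      is_hyperbolic_zero F (hyperbolic_zero F),
      julia_zero 2 F = H2_to_H3 (hyperbolic_zero F)
    & is_hyperbolic_midpoint (hyperbolic_zero F) alpha1 alpha2].
Proof.
have jE w := is_julia_zeroE w halpha.
have hE Q := is_hyperbolic_zeroE Q halpha.
have -> : julia_zero 2 F = H2_to_H3 (midpoint alpha1 alpha2).
  by apply: xget_unique => [|w]; [exact/jE | move/jE].
have -> : hyperbolic_zero F = midpoint alpha1 alpha2.
  by apply: xget_unique => [|Q]; [exact/hE | move/hE].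
split=> //; [exact/jE | exact/hE | exact: midpoint_is_midpoint].
Qed.
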